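(* Let $\delta_0>0$ be fixed. Then there exists $\mu_0>0$ such that for all $\mu\ge\mu_0$ the following holds: if $\widetilde\varrho$ is a defining function for the worm domain $\mathcal W=\mathcal W_\mu$ and $\delta>0$ is such that $-(-\widetilde\varrho)^\delta$ is a bounded plurisubharmonic exhaustion function for $\mathcal W_\mu$, then $\delta<\delta_0$. More precisely, for every $\mu>0$: if $\widetilde\varrho$ is a defining function for $\mathcal W_\mu$ and $\delta>0$ is such that $-(-\widetilde\varrho)^\delta$ is a bounded plurisubharmonic exhaustion function for $\mathcal W_\mu$, then $\delta<\nu:=\pi/(2\mu)$.
   Context: For $\mu>0$, the (smooth) worm domain is $$\mathcal W=\mathcal W_\mu=\Big\{(z_1,z_2)\in\mathbf C^2:\ \big|z_1-e^{i\log|z_2|^2}\big|^2<1-\eta(\log|z_2|^2)\Big\}$$ (so $z_2\ne 0$), where $\eta:\mathbf R\to\mathbf R$ is any fixed $C^\infty$ function satisfying: (i) $\eta\ge0$, $\eta$ is even, $\eta$ is convex; (ii) $\eta^{-1}(0)=[-\mu,\mu]$; (iii) there is $a>0$ such that $\eta(x)>1$ if $|x|>a$; (iv) $\eta'(x)\neq0$ if $\eta(x)=1$. A defining function for a smoothly bounded domain $\Omega$ is a real-valued $C^\infty$ function $r$ on a neighborhood of $\overline\Omega$ with $\Omega=\{r<0\}$, $\partial\Omega=\{r=0\}$ and $\nabla r\ne0$ on $\partial\Omega$. A function $\lambda$ is a bounded plurisubharmonic exhaustion function for a domain $\Omega$ if: (a) $\lambda$ is continuous on $\overline\Omega$; (b)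 $\lambda$ is strictly plurisubharmonic on $\Omega$; (c) $\lambda=0$ on $\partial\Omega$; (d) $\lambda<0$ on $\Omega$; (e) for any $c<0$ the set $\{z\in\Omega:\lambda(z)<c\}$ is relatively compact in $\Omega$. *)

(* Defs.v *)
From HB Require Import structures.
From mathcomp Require Import all_boot all_order all_algebra.
From mathcomp Require Export complex.
From mathcomp Require Import all_classical all_reals all_analysis.

Set Implicit Arguments.
Unset Strict Implicit.
Unset Printing Implicit Defensive.

Import Order.TTheory GRing.Theory Num.Theory.
Import numFieldNormedType.Exports.

Local Open Scope ring_scope.
Local Open Scope classical_set_scope.
Local Open Scope complex_scope.

Section Smoothness.
Context {R : realType} {V : normedModType R}.

Fixpoint iter_derive (vs : seq V) (f : V -> R) : V -> R :=
  if vs is v :: vs' then 'D_v (iter_derive vs' f) else f.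

(* For an open set U.  Differentiability is Frechet differentiability, so that
   (in finite dimension) this is the usual class C^k; the derivatives of order
   k are only required to be continuous. *)
Definition Ck_on (k : nat) (U : set V) (f : V -> R) : Prop :=
  forall (vs : seq V) (x : V), U x ->
    ((size vs <= k)%N -> {for x, continuous (iter_derive vs f)}) /\
    ((size vs < k)%N -> differentiable (iter_derive vs f) x).

Definition smooth_on (U : set V) (f : V -> R) : Prop :=
  forall k, Ck_on k U f.

End Smoothness.

Definition boundary {T : topologicalType} (A : set T) : set T :=
  closure A `\` interior A.

Definition relatively_compact_in {T : topologicalType} (A B : set T) : Prop :=
  compact (closure A) /\ closure A `<=` B.

(* C^2 as the real normed space of the points ((x1, y1), (x2, y2)), with
   z_j = x_j + i y_j.  The type R[i] has no canonical structure of normed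
   space over R, and real partial derivatives are needed for plurisubharmonic
   functions. *)
Definition C2 (R : realType) : normedModType R := ((R * R) * (R * R))%type.

Section ComplexPlane2.
Context {R : realType}.
Local Notation C2 := (C2 R).

Definition z1 (z : C2) : R[i] := z.1.1 +i* z.1.2.
Definition z2 (z : C2) : R[i] := z.2.1 +i* z.2.2.

Definition xdir (j : 'I_2) : C2 :=
  if j == 0 then ((1, 0), (0, 0)) else ((0, 0), (1, 0)).
Definition ydir (j : 'I_2) : C2 :=
  if j == 0 then ((0, 1), (0, 0)) else ((0, 0), (0, 1)).

Definition gradient (f : C2 -> R) (z : C2) : C2 :=
  (('D_(xdir 0) f z, 'D_(ydir 0) f z), ('D_(xdir 1) f z, 'D_(ydir 1) f z)).

Definition cderive (v : C2) (f : C2 -> R[i]) (z : C2) : R[i] :=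
  'D_v (fun p => complex.Re (f p)) z +i* 'D_v (fun p => complex.Im (f p)) z.

(* the Wirtinger operators d/dz_j and d/d\bar z_j *)
Definition d_dz (j : 'I_2) (f : C2 -> R[i]) (z : C2) : R[i] :=
  2^-1 * (cderive (xdir j) f z - 'i%C * cderive (ydir j) f z).
Definition d_dzbar (j : 'I_2) (f : C2 -> R[i]) (z : C2) : R[i] :=
  2^-1 * (cderive (xdir j) f z + 'i%C * cderive (ydir j) f z).

Definition levi_form (u : C2 -> R) (z : C2) (w : 'rV[R[i]]_2) : R[i] :=
  \sum_(j < 2) \sum_(k < 2)
    d_dz j (d_dzbar k (fun p => (u p)%:C)) z * w 0 j * conjc (w 0 k).

(* For functions of class C^2, by positivity of the complex Hessian.
   The order of R[i] makes [0 < c] say that c is real and positive. *)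
Definition strictly_psh (Omega : set C2) (u : C2 -> R) : Prop :=
  Ck_on 2 Omega u /\
  forall (z : C2) (w : 'rV[R[i]]_2), Omega z -> w != 0 -> 0 < levi_form u z w.

Definition defining_function (Omega : set C2) (r : C2 -> R) : Prop :=
  exists U : set C2,
    [/\ open U /\ closure Omega `<=` U,
        smooth_on U r,
        Omega = [set z | U z /\ r z < 0],
        boundary Omega = [set z | U z /\ r z = 0] &
        forall z, boundary Omega z -> gradient r z != 0].

Definition bounded_psh_exhaustion (Omega : set C2) (u : C2 -> R) : Prop :=
  [/\ {within closure Omega, continuous u},
      strictly_psh Omega u,
      forall z, boundary Omega z -> u z = 0,
      forall z, Omega z -> u z < 0 &
      forall c : R, c < 0 ->
        relatively_compact_in [set z | Omega z /\ u z < c] Omega].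

Definition worm_profile (mu : R) (eta : R -> R) : Prop :=
  [/\ forall (n : nat) (x : R), derivable (eta^`(n)) x 1,
      [/\ forall x, 0 <= eta x,
          forall x, eta (- x) = eta x &
          convex_function (setT : set (convex_lmodType R^o)) eta],
      eta @^-1` [set 0] = `[- mu, mu]%classic,
      exists2 a : R, 0 < a & forall x : R, a < `|x| -> 1 < eta x &
      forall x, eta x = 1 -> eta^`() x != 0].

Definition expi (t : R) : R[i] := cos t +i* sin t.

Definition worm (eta : R -> R) : set C2 :=
  [set z | z2 z != 0 /\
     let t := ln (Normc.normc (z2 z) ^+ 2) in
     Normc.normc (z1 z - expi t) ^+ 2 < 1 - eta t].

End ComplexPlane2.

(* Main.v *)
(* Suppose that delta >= pi / (2 mu) and put T = pi / (2 delta), so T <= mu.  The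
   holomorphic curve w = t + is |-> (e^{iw}, e^{w/2}) maps the half-strip |t| <= T,
   s > 0 into the worm, with |z1| = e^{-s}, so u = -(-rho)^delta pulls back to a
   strictly subharmonic function of (t, s).  On the annulus z1 = 0,
   |log|z2|^2| <= mu in the boundary, the derivative of rho in the direction
   e^{it} of z1 is negative; by compactness -rho is between two constant multiples
   of e^{-s} along the curve, and hence m e^{-delta s} <= -u <= M e^{-delta s} for
   s >= S.  Since cos (delta T) = 0, the harmonic function
   h = e^{-delta s} ((s - S) cos (delta t) + t sin (delta t)) has boundary values
   T e^{-delta s} on |t| = T, and the maximum principle gives u + (m / T) h <= 0.
   At t = 0 this reads -u >= (m / T) (s - S) e^{-delta s}, which contradicts the
   upper bound for large s. *)
Require Import Defs.
From mathcomp Require Import all_boot all_order all_algebra.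
From mathcomp Require Import all_classical all_reals all_analysis.
From mathcomp Require Import ring lra.

Set Implicit Arguments.
Unset Strict Implicit.
Unset Printing Implicit Defensive.

Import Order.TTheory GRing.Theory Num.Theory.
Import numFieldNormedType.Exports.
Local Open Scope classical_set_scope.
Local Open Scope ring_scope.

(** * Real calculus *)

Lemma is_derive_curve (R : realType) (V : normedModType R) (f : V -> R)
    (c : R -> V) (t : R) (v : V) :
  differentiable f (c t) -> is_derive t 1 c v ->
  is_derive t 1 (fun x => f (c x)) ('D_v f (c t)).
Proof.
move=> df [dc <-].
have Dc : differentiable c t by exact/derivable1_diffP.
have Dfc : differentiable (f \o c) t by exact: differentiable_comp.
apply: DeriveDef; first exact: (diff_derivable (f := f \o c)).
by rewrite (deriveE _ Dfc) diff_comp//= (deriveE _ df) (deriveE _ Dc).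
Qed.

Lemma is_derive_pair (R : realType) (U V : normedModType R) (f : R -> U)
    (g : R -> V) (t : R) (df : U) (dg : V) :
  is_derive t 1 f df -> is_derive t 1 g dg ->
  is_derive t 1 (fun x => (f x, g x)) (df, dg).
Proof.
move=> [Df <-] [Dg <-].
have Df' : differentiable f t by exact/derivable1_diffP.
have Dg' : differentiable g t by exact/derivable1_diffP.
have D : differentiable (fun x => (f x, g x)) t by exact: differentiable_pair.
apply: DeriveDef; first exact: diff_derivable.
by rewrite (deriveE _ D) diff_pair// (deriveE _ Df') (deriveE _ Dg').
Qed.

Lemma derive_C2 (R : realType) (f : C2 R -> R) (p : C2 R) (a b c d : R) :
  differentiable f p ->
  'D_((a, b), (c, d)) f p =
    a * 'D_(xdir 0) f p + b * 'D_(ydir 0) f p +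
    c * 'D_(xdir 1) f p + d * 'D_(ydir 1) f p.
Proof.
move=> df; rewrite !(deriveE _ df).
have -> : ((a, b), (c, d)) = a *: (xdir 0 : C2 R) + b *: (ydir 0 : C2 R) +
    c *: (xdir 1 : C2 R) + d *: (ydir 1 : C2 R) :> C2 R.
  by congr ((_, _), (_, _)); rewrite /= /GRing.scale /=; ring.
by rewrite !linearD !linearZ.
Qed.

Lemma derive_gt0_right (R : realType) (g : R -> R) (x l : R) :
  is_derive x 1 g l -> 0 < l -> \forall t \near x^'+, g x < g t.
Proof.
move=> [dg gl] l0.
have : (fun h : R => h^-1 *: (g (h *: 1 + x) - g x)) @ 0^' --> l.
  by rewrite -gl; exact: dg.
move/cvgr_gt => /(_ _ l0) [e /= e0 He].
exists e => //= t /= xte xt.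
have h0 : t - x != 0 by rewrite subr_eq0 gt_eqF.
have := He (t - x); rewrite /ball_ /= sub0r normrN distrC => /(_ xte h0).
rewrite {1}/GRing.scale /= {1}/GRing.scale /= mulr1 subrK.
by rewrite pmulr_rgt0 ?invr_gt0 ?subr_gt0.
Qed.

(** If [l > 0], then [g], which vanishes at the maximum [x], is positive just to its right, and the
    mean value theorem makes [f] exceed [f x] there. *)
Lemma second_derive_le0_max (R : realType) (f g : R -> R) (a b x l : R) :
  a < x < b ->
  (forall t, a < t < b -> is_derive t 1 f (g t)) ->
  is_derive x 1 g l ->
  (forall t, a < t < b -> f t <= f x) -> l <= 0.
Proof.
move=> axb df dg fmax; rewrite leNgt; apply/negP => l0.
have /andP[ax xb] := axb.
have gx0 : g x = 0.
  have dfx := df _ axb.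
  have : is_derive x 1 f 0.
    apply: (@derive1_at_max _ f a b) => [|t||t]; rewrite ?in_itv//.
    - by rewrite (ltW (lt_trans ax xb)).
    - by move=> /df[].
    - by move=> /fmax.
  by case=> _; case: dfx => _ -> .
have [e /= e0 He] := derive_gt0_right dg l0.
pose t := Num.min ((x + b) / 2) (x + e / 2).
have xt : x < t by rewrite lt_min; lra.
have tb : t < b by rewrite gt_min; lra.
have te : t - x < e by rewrite ltrBlDr gt_min; lra.
have dfi y : x <= y <= t -> is_derive y 1 f (g y) by move=> ?; apply: df; lra.
have [c cxt fE] : exists2 c, c \in `]x, t[ & f t - f x = g c * (t - x).
  apply: MVT => // [y|]; first by rewrite in_itv/= => ?; apply: dfi; lra.
  apply: derivable_within_continuous => y; rewrite in_itv/= => /dfi.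
  by case.
move: cxt; rewrite in_itv/= => cxt.
have : g x < g c.
  by apply: He; rewrite /= ?ltr0_norm; lra.
have : f t <= f x by apply: fmax; lra.
rewrite gx0 -subr_le0 fE pmulr_lle0 ?subr_gt0//; lra.
Qed.

(** * The Levi form and the real Hessian *)

Section LeviForm.
Local Open Scope complex_scope.
Context {R : realType}.
Local Notation C2 := (C2 R).

(** For twice differentiable [u], the second derivative along the line through [z] with direction
    [v]. The outer derivative stays a single directional one, as it arises when the gradient is
    differentiated along a curve. *)
Definition hess (u : C2 -> R) (z v : C2) : R :=
  v.1.1 * 'D_v ('D_(xdir 0) u) z + v.1.2 * 'D_v ('D_(ydir 0) u) z +
  v.2.1 * 'D_v ('D_(xdir 1) u) z + v.2.2 * 'D_v ('D_(ydir 1) u) z.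

Lemma half_complexE (a b : R) : 2^-1 * (a +i* b) = (2^-1 * a) +i* (2^-1 * b) :> R[i].
Proof.
have -> : 2^-1 = (2^-1)%:C :> R[i] by rewrite fmorphV rmorph_nat.
by apply/eqP; rewrite eq_complex /= !mul0r subr0 addr0 !eqxx.
Qed.

Lemma sum_ord2 (F : 'I_2 -> 'I_2 -> R[i]) :
  \sum_(j < 2) \sum_(k < 2) F j k = F 0 0 + F 0 1 + (F 1 0 + F 1 1).
Proof.
rewrite !big_ord_recl !big_ord0 !addr0.
by have -> : lift ord0 (ord0 : 'I_1) = 1 :> 'I_2 by exact/val_inj.
Qed.

Lemma addi_complexE (a b c d : R) :
  (a +i* b) + 'i%C * (c +i* d) = (a - d) +i* (b + c) :> R[i].
Proof. by apply/eqP; rewrite eq_complex /= !mul0r !mul1r sub0r add0r !eqxx. Qed.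

Lemma subi_complexE (a b c d : R) :
  (a +i* b) - 'i%C * (c +i* d) = (a + d) +i* (b - c) :> R[i].
Proof.
by apply/eqP; rewrite eq_complex /= !mul0r !mul1r sub0r add0r opprK !eqxx.
Qed.

(** [XY j k] stands for the x_j-derivative of the y_k-derivative, and so on; [C j k] is then a mixed
    Wirtinger derivative. Adding the values at v and iv keeps only the part of the quadratic form
    invariant under multiplication by i, which is the Hermitian part. *)
Lemma levi_algebra (C : 'I_2 -> 'I_2 -> R[i]) (XX XY YX YY : 'I_2 -> 'I_2 -> R)
    (a b c d : R) :
  (forall j k, C j k = (2^-1 * (2^-1 * XX j k + 2^-1 * YY j k)) +i*
                       (2^-1 * (2^-1 * XY j k - 2^-1 * YX j k))) ->
  let w := \row_(j < 2) if j == 0 then a +i* b else c +i* d in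
  a * (a * XX 0 0 + b * YX 0 0 +
         c * XX 1 0 + d * YX 1 0) +
    b * (a * XY 0 0 + b * YY 0 0 +
         c * XY 1 0 + d * YY 1 0) +
    c * (a * XX 0 1 + b * YX 0 1 +
         c * XX 1 1 + d * YX 1 1) +
    d * (a * XY 0 1 + b * YY 0 1 +
         c * XY 1 1 + d * YY 1 1) +
    ((- b) * ((- b) * XX 0 0 + a * YX 0 0 +
         (- d) * XX 1 0 + c * YX 1 0) +
    a * ((- b) * XY 0 0 + a * YY 0 0 +
         (- d) * XY 1 0 + c * YY 1 0) +
    (- d) * ((- b) * XX 0 1 + a * YX 0 1 +
         (- d) * XX 1 1 + c * YX 1 1) +
    c * ((- b) * XY 0 1 + a * YY 0 1 +
         (- d) * XY 1 1 + c * YY 1 1)) =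
  4 * complex.Re (\sum_(j < 2) \sum_(k < 2) C j k * w 0 j * conjc (w 0 k)).
Proof. by move=> CE w; rewrite sum_ord2 !CE !mxE /=; field. Qed.

(* The second vector is [i] times the first.  Symmetry of the second derivatives
   is not needed, because only the real part of the Levi form is taken. *)
Lemma levi_form_hess (u : C2 -> R) (z : C2) (a b c d : R) :
  (forall j, differentiable ('D_(xdir j) u) z) ->
  (forall j, differentiable ('D_(ydir j) u) z) ->
  hess u z ((a, b), (c, d)) + hess u z ((- b, a), (- d, c)) =
  4 * complex.Re (levi_form u z
        (\row_(j < 2) if j == 0 then a +i* b else c +i* d)).
Proof.
move=> dx dy.
have dzbarE k : d_dzbar k (fun p => (u p)%:C) =
    fun p => (2^-1 * 'D_(xdir k) u p) +i* (2^-1 * 'D_(ydir k) u p).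
  apply/funext => p; rewrite /d_dzbar /cderive addi_complexE half_complexE /=.
  have D0 v : 'D_v (fun=> 0 : R) p = 0 :> R by exact: (derive_cst (V := C2)).
  by rewrite !D0 subr0 add0r.
have DZ v (f : C2 -> R) : differentiable f z ->
    'D_v (fun p => 2^-1 * f p) z = 2^-1 * 'D_v f z.
  by move=> df; exact: (deriveZ 2^-1 (@diff_derivable _ _ _ _ _ v df)).
have dzE j k : d_dz j (d_dzbar k (fun p => (u p)%:C)) z =
    (2^-1 * (2^-1 * 'D_(xdir j) ('D_(xdir k) u) z +
             2^-1 * 'D_(ydir j) ('D_(ydir k) u) z)) +i*
    (2^-1 * (2^-1 * 'D_(xdir j) ('D_(ydir k) u) z -
             2^-1 * 'D_(ydir j) ('D_(xdir k) u) z)).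
  rewrite dzbarE /d_dz /cderive subi_complexE half_complexE.
  congr ((_ * (_ + _)) +i* (_ * (_ - _))); first exact: DZ (dx k).
  - exact: DZ (dy k).
  - exact: DZ (dy k).
  - exact: DZ (dx k).
have hessE p q r s : hess u z ((p, q), (r, s)) =
    p * (p * 'D_(xdir 0) ('D_(xdir 0) u) z + q * 'D_(ydir 0) ('D_(xdir 0) u) z +
         r * 'D_(xdir 1) ('D_(xdir 0) u) z + s * 'D_(ydir 1) ('D_(xdir 0) u) z) +
    q * (p * 'D_(xdir 0) ('D_(ydir 0) u) z + q * 'D_(ydir 0) ('D_(ydir 0) u) z +
         r * 'D_(xdir 1) ('D_(ydir 0) u) z + s * 'D_(ydir 1) ('D_(ydir 0) u) z) +
    r * (p * 'D_(xdir 0) ('D_(xdir 1) u) z + q * 'D_(ydir 0) ('D_(xdir 1) u) z +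
         r * 'D_(xdir 1) ('D_(xdir 1) u) z + s * 'D_(ydir 1) ('D_(xdir 1) u) z) +
    s * (p * 'D_(xdir 0) ('D_(ydir 1) u) z + q * 'D_(ydir 0) ('D_(ydir 1) u) z +
         r * 'D_(xdir 1) ('D_(ydir 1) u) z + s * 'D_(ydir 1) ('D_(ydir 1) u) z).
  congr (_ * _ + _ * _ + _ * _ + _ * _).
  - exact: derive_C2 (dx 0).
  - exact: derive_C2 (dy 0).
  - exact: derive_C2 (dx 1).
  - exact: derive_C2 (dy 1).
rewrite !hessE.
exact: (levi_algebra a b c d dzE).
Qed.

End LeviForm.

(** * Derivative rules in pointwise form *)

Section RealDerivatives.
Context {R : realType}.
Implicit Types (f g : R -> R) (x df dg : R).

Lemma is_derive_funM f g x df dg : is_derive x 1 f df -> is_derive x 1 g dg ->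
  is_derive x 1 (fun t => f t * g t) (df * g x + f x * dg).
Proof.
move=> Df Dg; apply: (is_derive_eq (is_deriveM Df Dg)).
by rewrite /GRing.scale /= addrC [g x * _]mulrC.
Qed.

Lemma is_derive_funD f g x df dg : is_derive x 1 f df -> is_derive x 1 g dg ->
  is_derive x 1 (fun t => f t + g t) (df + dg).
Proof. exact: is_deriveD. Qed.

Lemma is_derive_funN f x df : is_derive x 1 f df ->
  is_derive x 1 (fun t => - f t) (- df).
Proof. exact: is_deriveN. Qed.

Lemma is_derive_fun_cst (c : R) x : is_derive x 1 (fun=> c) 0.
Proof. exact: is_derive_cst. Qed.

Lemma is_derive_fun_id x : is_derive x 1 (fun t : R => t) 1.
Proof. exact: is_derive_id. Qed.

Lemma is_derive_fun_comp f g x df dg : is_derive x 1 f df ->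
  is_derive (f x) 1 g dg -> is_derive x 1 (fun t => g (f t)) (df * dg).
Proof.
by move=> Df Dg; rewrite mulrC; exact: is_derive1_comp Dg Df.
Qed.

Lemma is_derive_fun_cos f x df : is_derive x 1 f df ->
  is_derive x 1 (fun t => cos (f t)) (df * - sin (f x)).
Proof. by move=> Df; apply: is_derive_fun_comp Df _; exact: is_derive_cos. Qed.

Lemma is_derive_fun_sin f x df : is_derive x 1 f df ->
  is_derive x 1 (fun t => sin (f t)) (df * cos (f x)).
Proof. by move=> Df; apply: is_derive_fun_comp Df _; exact: is_derive_sin. Qed.

Lemma is_derive_fun_expR f x df : is_derive x 1 f df ->
  is_derive x 1 (fun t => expR (f t)) (df * expR (f x)).
Proof. by move=> Df; apply: is_derive_fun_comp Df _; exact: is_derive_expR. Qed.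

End RealDerivatives.

(* The proof term is built by syntactic matching: unification against [expR],
   [cos] or ['D_v f] would unfold them and diverge. *)
Ltac is_derive_term x f :=
  lazymatch f with
  | (fun _ => ?c) => constr:(is_derive_fun_cst c x)
  | (fun t => t) => constr:(is_derive_fun_id x)
  | (fun t => @?g t * @?h t) =>
      let p := is_derive_term x g in let q := is_derive_term x h in
      constr:(is_derive_funM p q)
  | (fun t => @?g t + @?h t) =>
      let p := is_derive_term x g in let q := is_derive_term x h in
      constr:(is_derive_funD p q)
  | (fun t => - @?g t) =>
      let p := is_derive_term x g in constr:(is_derive_funN p)
  | (fun t => cos (@?g t)) =>
      let p := is_derive_term x g in constr:(is_derive_fun_cos p)
  | (fun t => sin (@?g t)) =>
      let p := is_derive_term x g in constr:(is_derive_fun_sin p)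
  | (fun t => expR (@?g t)) =>
      let p := is_derive_term x g in constr:(is_derive_fun_expR p)
  end.

Ltac prove_is_derive :=
  lazymatch goal with
  | |- is_derive ?x _ ?f _ =>
      let p := is_derive_term x f in apply: (is_derive_eq p); field
  end.

(** * Second derivatives of a function along a curve in C^2 *)

Section Curves.
Context {R : realType}.
Local Notation C2 := (C2 R).

(** The differential of [u] at [z] applied to [v], expanded in partial derivatives so that the
    product rule applies along a curve. *)
Definition grad_dot (u : C2 -> R) (z v : C2) : R :=
  v.1.1 * 'D_(xdir 0) u z + v.1.2 * 'D_(ydir 0) u z +
  v.2.1 * 'D_(xdir 1) u z + v.2.2 * 'D_(ydir 1) u z.

Section Curve.
Variables (x1 y1 x2 y2 : R -> R) (u : C2 -> R).
Let c (s : R) : C2 := ((x1 s, y1 s), (x2 s, y2 s)).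

Lemma is_derive_C2_curve (s p q p' q' : R) :
  is_derive s 1 x1 p -> is_derive s 1 y1 q ->
  is_derive s 1 x2 p' -> is_derive s 1 y2 q' ->
  differentiable u (c s) ->
  is_derive s 1 (fun s => u (c s)) (grad_dot u (c s) ((p, q), (p', q'))).
Proof.
move=> Dp Dq Dp' Dq' Du.
apply: is_derive_eq.
  apply: (is_derive_curve (c := c)) => //.
  by do !apply: is_derive_pair.
exact: derive_C2.
Qed.

(** The product rule splits the second derivative of [u] on the curve c into the Hessian in the
    direction c' and the gradient paired with the acceleration c''. *)
Lemma second_is_derive_C2_curve (dx1 dy1 dx2 dy2 : R -> R) (s p q p' q' : R) :
  is_derive s 1 x1 (dx1 s) -> is_derive s 1 y1 (dy1 s) ->
  is_derive s 1 x2 (dx2 s) -> is_derive s 1 y2 (dy2 s) ->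
  is_derive s 1 dx1 p -> is_derive s 1 dy1 q ->
  is_derive s 1 dx2 p' -> is_derive s 1 dy2 q' ->
  (forall j, differentiable ('D_(xdir j) u) (c s)) ->
  (forall j, differentiable ('D_(ydir j) u) (c s)) ->
  let dc s : C2 := ((dx1 s, dy1 s), (dx2 s, dy2 s)) in
  is_derive s 1 (fun s => grad_dot u (c s) (dc s))
    (hess u (c s) (dc s) + grad_dot u (c s) ((p, q), (p', q'))).
Proof.
move=> D1 D2 D3 D4 Dp Dq Dp' Dq' Dx Dy dc.
have Dc : is_derive s 1 c (dc s) by do !apply: is_derive_pair.
have DX j : is_derive s 1 (fun s => 'D_(xdir j) u (c s))
    ('D_(dc s) ('D_(xdir j) u) (c s)) by exact: is_derive_curve.
have DY j : is_derive s 1 (fun s => 'D_(ydir j) u (c s))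
    ('D_(dc s) ('D_(ydir j) u) (c s)) by exact: is_derive_curve.
apply: (is_derive_eq (is_derive_funD (is_derive_funD (is_derive_funD
  (is_derive_funM Dp (DX 0)) (is_derive_funM Dq (DY 0)))
  (is_derive_funM Dp' (DX 1))) (is_derive_funM Dq' (DY 1)))).
have alg (a b a1 b1 a2 b2 a3 b3 a4 b4 c1 c2 c3 c4 d1 d2 : R) :
    a * a1 + b * b1 + (c1 * a2 + d1 * b2) + (c2 * a3 + d2 * b3) + (c3 * a4 + c4 * b4) =
    (b * b1 + d1 * b2 + d2 * b3 + c4 * b4) + (a * a1 + c1 * a2 + c2 * a3 + c3 * a4).
  by ring.
exact: alg.
Qed.

End Curve.
End Curves.

(** * Subharmonicity along the worm curve *)

Lemma continuous_pair (R : realType) (T : topologicalType) (U V : normedModType R)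
    (f : T -> U) (g : T -> V) :
  continuous f -> continuous g -> continuous (fun x => (f x, g x)).
Proof. by move=> cf cg p; apply: cvg_pair; [exact: cf|exact: cg]. Qed.

Section WormCurve.
Context {R : realType}.
Local Notation C2 := (C2 R).

(** The point (r e^{it}, e^{(t+is)/2}), for which log |z2|^2 = t. The radius is a variable of its
    own: r = 0 gives the boundary annulus, r = e^{-s} the holomorphic curve. *)
Definition worm_point (q : R * (R * R)) : C2 :=
  ((q.1 * cos q.2.1, q.1 * sin q.2.1),
   (expR (q.2.1 / 2) * cos (q.2.2 / 2), expR (q.2.1 / 2) * sin (q.2.2 / 2))).

Lemma continuous_worm_point : continuous worm_point.
Proof.
have cE (f : R * (R * R) -> R) : continuous f -> continuous (fun p => expR (f p)).
  by move=> cf p; apply: (@continuous_comp _ _ _ f expR);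
    [exact: cf|exact: continuous_expR].
have cC (f : R * (R * R) -> R) : continuous f -> continuous (fun p => cos (f p)).
  by move=> cf p; apply: (@continuous_comp _ _ _ f cos);
    [exact: cf|exact: continuous_cos].
have cS (f : R * (R * R) -> R) : continuous f -> continuous (fun p => sin (f p)).
  by move=> cf p; apply: (@continuous_comp _ _ _ f sin);
    [exact: cf|exact: continuous_sin].
have c0 : continuous (fun p : R * (R * R) => p.1) by move=> p; exact: cvg_fst.
have c' : continuous (fun p : R * (R * R) => p.2) by move=> p; exact: cvg_snd.
have c1 : continuous (fun p : R * (R * R) => p.2.1).
  by move=> p; apply: (@continuous_comp _ _ _ snd fst);
    [exact: c'|exact: cvg_fst].
have c2 : continuous (fun p : R * (R * R) => p.2.2).
  by move=> p; apply: (@continuous_comp _ _ _ snd snd);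
    [exact: c'|exact: cvg_snd].
have h1 : continuous (fun p : R * (R * R) => p.2.1 / 2).
  by move=> p; exact: cvgM (c1 p) (cvg_cst _).
have h2 : continuous (fun p : R * (R * R) => p.2.2 / 2).
  by move=> p; exact: cvgM (c2 p) (cvg_cst _).
have A : continuous (fun p : R * (R * R) => p.1 * cos p.2.1).
  by move=> p; exact: cvgM (c0 p) (cC _ c1 p).
have B : continuous (fun p : R * (R * R) => p.1 * sin p.2.1).
  by move=> p; exact: cvgM (c0 p) (cS _ c1 p).
have C : continuous (fun p : R * (R * R) => expR (p.2.1 / 2) * cos (p.2.2 / 2)).
  by move=> p; exact: cvgM (cE _ h1 p) (cC _ h2 p).
have D : continuous (fun p : R * (R * R) => expR (p.2.1 / 2) * sin (p.2.2 / 2)).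
  by move=> p; exact: cvgM (cE _ h1 p) (cS _ h2 p).
exact: continuous_pair (continuous_pair A B) (continuous_pair C D).
Qed.

(* [worm_curve t s] is (e^{iw}, e^{w/2}) at w = t + is: a holomorphic curve. *)
Definition worm_curve (t s : R) : C2 := worm_point (expR (- s), (t, s)).

Definition worm_curve_t (t s : R) : C2 :=
  ((- (expR (- s) * sin t), expR (- s) * cos t),
   (2^-1 * (expR (t / 2) * cos (s / 2)), 2^-1 * (expR (t / 2) * sin (s / 2)))).

(** By the Cauchy-Riemann equations this is i times [worm_curve_t], as [levi_form_hess] requires. *)
Definition worm_curve_s (t s : R) : C2 :=
  ((- (expR (- s) * cos t), - (expR (- s) * sin t)),
   (- (2^-1 * (expR (t / 2) * sin (s / 2))), 2^-1 * (expR (t / 2) * cos (s / 2)))).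

Lemma cos_sin_neq0 (t : R) : (cos t == 0) && (sin t == 0) = false.
Proof.
apply/negP => /andP[/eqP c0 /eqP s0]; have := cos2Dsin2 t.
by rewrite c0 s0 expr0n /= addr0 => /eqP; rewrite eq_sym oner_eq0.
Qed.

Section SubharmonicOnCurve.
Variables (Omega : set C2) (u : C2 -> R).
Hypothesis psh : strictly_psh Omega u.

Lemma psh_differentiable z : Omega z -> differentiable u z.
Proof. by move=> /(psh.1 [::] z)[_]; apply. Qed.

Lemma psh_partial_x z j : Omega z -> differentiable ('D_(xdir j) u) z.
Proof. by move=> /(psh.1 [:: xdir j] z)[_]; apply. Qed.

Lemma psh_partial_y z j : Omega z -> differentiable ('D_(ydir j) u) z.
Proof. by move=> /(psh.1 [:: ydir j] z)[_]; apply. Qed.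

(** The sum is four times the Levi form on the complex tangent, which is nonzero because its first
    component i e^{iw} has modulus e^{-s}. *)
Lemma hess_worm_curve_gt0 t s : Omega (worm_curve t s) ->
  0 < hess u (worm_curve t s) (worm_curve_t t s) +
      hess u (worm_curve t s) (worm_curve_s t s).
Proof.
move=> Oz.
have := levi_form_hess (- (expR (- s) * sin t)) (expR (- s) * cos t)
  (2^-1 * (expR (t / 2) * cos (s / 2))) (2^-1 * (expR (t / 2) * sin (s / 2)))
  (fun j => psh_partial_x j Oz) (fun j => psh_partial_y j Oz).
rewrite /worm_curve_t /worm_curve_s => ->.
set w := (\row_j _).
have : w != 0.
  apply/eqP => /matrixP/(_ 0 0); rewrite !mxE /= => /eqP.
  rewrite eq_complex /= oppr_eq0 !mulf_eq0 expR_eq0 /= andbC.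
  by rewrite cos_sin_neq0.
move=> /(psh.2 _ _ Oz); rewrite ltcE /= => /andP[_].
by rewrite pmulr_rgt0.
Qed.

(** At such a maximum both second derivatives of [u + h] are nonpositive. In their sum the Laplacian
    of [h] vanishes, the acceleration terms cancel, and the positive quantity of
    [hess_worm_curve_gt0] remains. *)
Lemma no_interior_max (h ht hs htt hss : R -> R -> R) (a b c d t0 s0 : R) :
  a < t0 < b -> c < s0 < d ->
  (forall t, a < t < b -> Omega (worm_curve t s0)) ->
  (forall s, c < s < d -> Omega (worm_curve t0 s)) ->
  (forall t s : R, is_derive t 1 (h^~ s) (ht t s)) ->
  (forall t s : R, is_derive s 1 (h t) (hs t s)) ->
  (forall t s : R, is_derive t 1 (ht^~ s) (htt t s)) ->
  (forall t s : R, is_derive s 1 (hs t) (hss t s)) ->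
  htt t0 s0 + hss t0 s0 = 0 ->
  (forall t, a < t < b ->
    u (worm_curve t s0) + h t s0 <= u (worm_curve t0 s0) + h t0 s0) ->
  (forall s, c < s < d ->
    u (worm_curve t0 s) + h t0 s <= u (worm_curve t0 s0) + h t0 s0) -> False.
Proof.
have contra (p q r w x y : R) : r + w = 0 -> p + r + x <= 0 -> q + w + y <= 0 ->
  x + y = 0 -> 0 < p + q -> False by lra.
move=> tab scd Ot Os Dt Ds Dtt Dss h0 tmax smax.
have Oz := Ot _ tab.
(* The index 1 to 4 names the real coordinate of the curve; a doubled letter marks its second
   derivative. *)
have Dt1 t s : is_derive t (1 : R)
    (fun t => expR (- s) * cos t)
    (- (expR (- s) * sin t)).
  by prove_is_derive.
have Dtt1 t s : is_derive t (1 : R)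
    (fun t => - (expR (- s) * sin t))
    (- (expR (- s) * cos t)).
  by prove_is_derive.
have Ds1 t s : is_derive s (1 : R)
    (fun s => expR (- s) * cos t)
    (- (expR (- s) * cos t)).
  by prove_is_derive.
have Dss1 t s : is_derive s (1 : R)
    (fun s => - (expR (- s) * cos t))
    (expR (- s) * cos t).
  by prove_is_derive.
have Dt2 t s : is_derive t (1 : R)
    (fun t => expR (- s) * sin t)
    (expR (- s) * cos t).
  by prove_is_derive.
have Dtt2 t s : is_derive t (1 : R)
    (fun t => expR (- s) * cos t)
    (- (expR (- s) * sin t)).
  by prove_is_derive.
have Ds2 t s : is_derive s (1 : R)
    (fun s => expR (- s) * sin t)
    (- (expR (- s) * sin t)).
  by prove_is_derive.
have Dss2 t s : is_derive s (1 : R)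
    (fun s => - (expR (- s) * sin t))
    (expR (- s) * sin t).
  by prove_is_derive.
have Dt3 t s : is_derive t (1 : R)
    (fun t => expR (t / 2) * cos (s / 2))
    (2^-1 * (expR (t / 2) * cos (s / 2))).
  by prove_is_derive.
have Dtt3 t s : is_derive t (1 : R)
    (fun t => 2^-1 * (expR (t / 2) * cos (s / 2)))
    (4^-1 * (expR (t / 2) * cos (s / 2))).
  by prove_is_derive.
have Ds3 t s : is_derive s (1 : R)
    (fun s => expR (t / 2) * cos (s / 2))
    (- (2^-1 * (expR (t / 2) * sin (s / 2)))).
  by prove_is_derive.
have Dss3 t s : is_derive s (1 : R)
    (fun s => - (2^-1 * (expR (t / 2) * sin (s / 2))))
    (- (4^-1 * (expR (t / 2) * cos (s / 2)))).
  by prove_is_derive.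
have Dt4 t s : is_derive t (1 : R)
    (fun t => expR (t / 2) * sin (s / 2))
    (2^-1 * (expR (t / 2) * sin (s / 2))).
  by prove_is_derive.
have Dtt4 t s : is_derive t (1 : R)
    (fun t => 2^-1 * (expR (t / 2) * sin (s / 2)))
    (4^-1 * (expR (t / 2) * sin (s / 2))).
  by prove_is_derive.
have Ds4 t s : is_derive s (1 : R)
    (fun s => expR (t / 2) * sin (s / 2))
    (2^-1 * (expR (t / 2) * cos (s / 2))).
  by prove_is_derive.
have Dss4 t s : is_derive s (1 : R)
    (fun s => 2^-1 * (expR (t / 2) * cos (s / 2)))
    (- (4^-1 * (expR (t / 2) * sin (s / 2)))).
  by prove_is_derive.
(* The second derivatives of the curve in t and in s; they are opposite because its coordinates are
   harmonic. *)
pose et : C2 := ((- (expR (- s0) * cos t0), - (expR (- s0) * sin t0)),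
   (4^-1 * (expR (t0 / 2) * cos (s0 / 2)), 4^-1 * (expR (t0 / 2) * sin (s0 / 2)))).
pose es : C2 := ((expR (- s0) * cos t0, expR (- s0) * sin t0),
   (- (4^-1 * (expR (t0 / 2) * cos (s0 / 2))), - (4^-1 * (expR (t0 / 2) * sin (s0 / 2))))).
have tle : hess u (worm_curve t0 s0) (worm_curve_t t0 s0) +
    grad_dot u (worm_curve t0 s0) et + htt t0 s0 <= 0.
  apply: (second_derive_le0_max tab (f := fun t => u (worm_curve t s0) + h t s0)
   (g := fun t => grad_dot u (worm_curve t s0) (worm_curve_t t s0) + ht t s0)
   _ _ tmax) => [t /Ot Dz|].
    exact: is_derive_funD (is_derive_C2_curve (Dt1 _ _) (Dt2 _ _)
      (Dt3 _ _) (Dt4 _ _) (psh_differentiable Dz)) (Dt _ _).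
  exact: is_derive_funD (second_is_derive_C2_curve
    (dx1 := fun t => (worm_curve_t t s0).1.1)
    (dy1 := fun t => (worm_curve_t t s0).1.2)
    (dx2 := fun t => (worm_curve_t t s0).2.1)
    (dy2 := fun t => (worm_curve_t t s0).2.2)
    (Dt1 _ _) (Dt2 _ _) (Dt3 _ _) (Dt4 _ _)
    (Dtt1 _ _) (Dtt2 _ _) (Dtt3 _ _) (Dtt4 _ _)
    (fun j => psh_partial_x j Oz) (fun j => psh_partial_y j Oz)) (Dtt _ _).
have sle : hess u (worm_curve t0 s0) (worm_curve_s t0 s0) +
    grad_dot u (worm_curve t0 s0) es + hss t0 s0 <= 0.
  apply: (second_derive_le0_max scd (f := fun s => u (worm_curve t0 s) + h t0 s)
   (g := fun s => grad_dot u (worm_curve t0 s) (worm_curve_s t0 s) + hs t0 s)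
   _ _ smax) => [s /Os Dz|].
    exact: is_derive_funD (is_derive_C2_curve (Ds1 _ _) (Ds2 _ _)
      (Ds3 _ _) (Ds4 _ _) (psh_differentiable Dz)) (Ds _ _).
  exact: is_derive_funD (second_is_derive_C2_curve
    (dx1 := fun s => (worm_curve_s t0 s).1.1)
    (dy1 := fun s => (worm_curve_s t0 s).1.2)
    (dx2 := fun s => (worm_curve_s t0 s).2.1)
    (dy2 := fun s => (worm_curve_s t0 s).2.2)
    (Ds1 _ _) (Ds2 _ _) (Ds3 _ _) (Ds4 _ _)
    (Dss1 _ _) (Dss2 _ _) (Dss3 _ _) (Dss4 _ _)
    (fun j => psh_partial_x j Oz) (fun j => psh_partial_y j Oz)) (Dss _ _).
have gE : grad_dot u (worm_curve t0 s0) et + grad_dot u (worm_curve t0 s0) es = 0.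
  have alg (p q r w x1 x2 x3 x4 : R) : - p * x1 + - q * x2 + r * x3 + w * x4 +
      (p * x1 + q * x2 + - r * x3 + - w * x4) = 0 by ring.
  exact: alg.
exact: contra gE tle sle h0 (hess_worm_curve_gt0 Oz).
Qed.

End SubharmonicOnCurve.
End WormCurve.

(** * Barrier and maximum principle on a rectangle of the strip *)

Section MaximumPrinciple.
Context {R : realType}.
Local Notation C2 := (C2 R).

Lemma continuous_worm_curve :
  continuous (fun p : R * R => worm_curve p.1 p.2 : C2).
Proof.
have cN : continuous (fun p : R * R => - p.2) by move=> p; apply: cvgN; exact: cvg_snd.
have cE : continuous (fun p : R * R => expR (- p.2)).
  move=> p; apply: (@continuous_comp _ _ _ (fun p : R * R => - p.2) expR).
    exact: cN.
  exact: continuous_expR.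
have c2 : continuous (fun p : R * R => (expR (- p.2), p)).
  by apply: continuous_pair cE _ => p; exact: cvg_id.
move=> [t s]; apply: (@continuous_comp _ _ _ (fun p : R * R => (expR (- p.2), p)) worm_point).
  exact: c2.
exact: continuous_worm_point.
Qed.

(** Since e^{dx} >= (1 + dx/2)^2, quadratic growth suffices: the witness satisfies x >= 1 and d^2
    x^2 / 4 >= (1 + A) x >= x + A. *)
Lemma affine_lt_expR (d A : R) : 0 < d -> 0 <= A ->
  exists2 x : R, 0 < x & x + A < expR (d * x).
Proof.
move=> d0 A0; exists (4 * (1 + A) / d ^+ 2 + 1).
  by rewrite ltr_pwDr// divr_ge0 ?exprn_ge0// ?ltW//; lra.
set x := _ + 1.
have x1 : 1 <= x by rewrite lerDr divr_ge0 ?exprn_ge0// ?ltW//; lra.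
have dx : d ^+ 2 * x = 4 * (1 + A) + d ^+ 2 by rewrite /x; field; rewrite gt_eqF.
have eh : 1 + d * x / 2 <= expR (d * x / 2) by exact: expR_ge1Dx.
have dx0 : 0 <= d * x by rewrite mulr_ge0//; lra.
have -> : d * x = d * x / 2 + d * x / 2 by lra.
rewrite expRD; apply: (@lt_le_trans _ _ ((1 + d * x / 2) * (1 + d * x / 2))); last first.
  by apply: ler_pM => //; lra.
have : d ^+ 2 * x * x = (4 * (1 + A) + d ^+ 2) * x by rewrite dx.
have : 0 <= A * (x - 1) by rewrite mulr_ge0//; lra.
have : 0 <= d ^+ 2 * x by rewrite mulr_ge0 ?exprn_ge0//; lra.
nra.
Qed.

Section Barrier.
Variables (Omega : set C2) (u : C2 -> R) (d T S m M : R).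
Hypotheses (psh : strictly_psh Omega u) (d0 : 0 < d) (dT : d * T = pi / 2)
  (m0 : 0 < m).
Hypothesis inO : forall t s, - T <= t <= T -> S <= s -> Omega (worm_curve t s).
Hypothesis ule : forall t s, - T <= t <= T -> S <= s ->
  u (worm_curve t s) <= - (m * expR (- (d * s))).
Hypothesis uge : forall t s, - T <= t <= T -> S <= s ->
  - (M * expR (- (d * s))) <= u (worm_curve t s).

(** Scales the barrier to equal m e^{-ds}, the bound in [ule], on the sides |t| = T. *)
Let k := m / T.
(* [h] is k Im ((w - iS) e^{idw}) at w = t + is, hence harmonic. *)
Let h t s := k * (expR (- (d * s)) * ((s + - S) * cos (d * t) + t * sin (d * t))).
Let ht t s := k * (expR (- (d * s)) *
  (- (d * ((s + - S) * sin (d * t))) + sin (d * t) + d * (t * cos (d * t)))).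
Let hs t s := k * (expR (- (d * s)) *
  (cos (d * t) + - (d * ((s + - S) * cos (d * t) + t * sin (d * t))))).
Let htt t s := k * (expR (- (d * s)) *
  (2 * d * cos (d * t) - d ^+ 2 * ((s + - S) * cos (d * t) + t * sin (d * t)))).
Let hss t s := k * (expR (- (d * s)) *
  (d ^+ 2 * ((s + - S) * cos (d * t) + t * sin (d * t)) - 2 * d * cos (d * t))).

Let Dt (t s : R) : is_derive t 1 (h^~ s) (ht t s).
Proof. by rewrite /h /ht; prove_is_derive. Qed.
Let Ds (t s : R) : is_derive s 1 (h t) (hs t s).
Proof. by rewrite /h /hs; prove_is_derive. Qed.
Let Dtt (t s : R) : is_derive t 1 (ht^~ s) (htt t s).
Proof. by rewrite /ht /htt; prove_is_derive. Qed.
Let Dss (t s : R) : is_derive s 1 (hs t) (hss t s).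
Proof. by rewrite /hs /hss; prove_is_derive. Qed.

Let T0 : 0 < T.
Proof. by rewrite -(pmulr_rgt0 _ d0) dT divr_gt0// pi_gt0. Qed.

Let k0 : 0 < k. Proof. exact: divr_gt0. Qed.

Let kT : k * T = m. Proof. by rewrite /k divfK// gt_eqF. Qed.

(** Here cos (d T) = 0 and sin (d T) = 1, so only the even term t sin (d t) survives, with value
    T. *)
Let h_side t s : t = T \/ t = - T -> h t s = m * expR (- (d * s)).
Proof.
case=> ->; rewrite /h ?mulrN ?cosN ?sinN dT cos_pihalf sin_pihalf;
by rewrite -kT; ring.
Qed.

Let tsin_le t : - T <= t <= T -> t * sin (d * t) <= T.
Proof.
move=> tT; have s1 := sin_le1 (d * t); have s2 := sin_geN1 (d * t).
by have [?|?] := lerP 0 t; nra.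
Qed.

Let h_bottom t : - T <= t <= T -> h t S <= m * expR (- (d * S)).
Proof.
move=> tT; rewrite /h subrr mul0r add0r -kT -mulrA ler_pM2l//.
by rewrite mulrC ler_pM2r ?expR_gt0// tsin_le.
Qed.

Let h_top t s : - T <= t <= T -> S <= s ->
  h t s <= k * (expR (- (d * s)) * (s - S + T)).
Proof.
move=> tT Ss; rewrite /h ler_pM2l// ler_pM2l ?expR_gt0// lerD ?tsin_le//.
by rewrite -[leRHS]mulr1 ler_wpM2l ?cos_le1// subr_ge0.
Qed.

(** On a tall rectangle [u + h] is at most 0 on the vertical sides and the bottom, positive at (0,
    s1), and smaller on the top than at (0, s1). Its maximum is therefore interior, which
    [no_interior_max] forbids. *)
Lemma no_psh_between_exponentials : False.
Proof.
have T_gt0 := T0.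
pose F p := u (worm_curve p.1 p.2) + h p.1 p.2.
(* At this height h = (|M| + k) e^{-d s1} on t = 0, which outweighs the lower bound -M e^{-d s1} of
   [u] by at least k e^{-d s1}. *)
pose s1 := S + `|M| / k + 1.
have Mk : 0 <= `|M| / k by rewrite divr_ge0// ltW.
have Ss1 : S <= s1 by rewrite /s1; lra.
have zT : - T <= 0 <= T by lra.
have F0 : k * expR (- (d * s1)) <= F (0, s1).
  have := uge zT Ss1; rewrite /F /= /h mulr0 cos0 sin0 => uM.
  have -> : s1 + - S = `|M| / k + 1 by rewrite /s1; ring.
  have -> : k * (expR (- (d * s1)) * ((`|M| / k + 1) * 1 + 0 * 0)) =
    (`|M| + k) * expR (- (d * s1)) by field; rewrite gt_eqF.
  have : 0 <= (`|M| - M) * expR (- (d * s1)).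
    by rewrite mulr_ge0 ?expR_ge0// subr_ge0 ler_norm.
  lra.
(* With the top at S' = s1 + x, the inequality S' - S + T = x + (s1 - S + T) < e^{dx} brings the
   bound of [h_top] below k e^{-d s1}. *)
have [x x0 xA] := @affine_lt_expR d (s1 - S + T) d0 ltac:(lra).
pose S' := s1 + x.
have topS' : k * (expR (- (d * S')) * (S' - S + T)) < k * expR (- (d * s1)).
  rewrite ltr_pM2l//.
  have -> : - (d * s1) = - (d * S') + d * x by rewrite /S'; ring.
  rewrite expRD ltr_pM2l ?expR_gt0//.
  by apply: le_lt_trans xA; rewrite /S'; lra.
pose K := `[- T, T] `*` `[S, S'] : set (R * R).
have KP p : p \in K -> (- T <= p.1 <= T) /\ (S <= p.2 <= S').
  by rewrite inE => -[]; rewrite /= !in_itv.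
have cK : compact K by apply: compact_setX; exact: segment_compact.
have K0 : (0, s1) \in K.
  by rewrite inE; split; rewrite /= in_itv/=; rewrite /S'; lra.
have Fc : {within K, continuous F}.
  apply: continuous_in_subspaceT => p /KP[p1 /andP[p2 _]].
  apply: cvgD.
    apply: (@continuous_comp _ _ _ (fun p : R * R => worm_curve p.1 p.2) u).
      exact: continuous_worm_curve.
    by apply: differentiable_continuous; apply: psh_differentiable psh _ _; exact: inO.
  have c1 : (fun p : R * R => p.1) @ p --> p.1 by exact: cvg_fst.
  have c2 : (fun p : R * R => p.2) @ p --> p.2 by exact: cvg_snd.
  have cd1 : (fun p : R * R => d * p.1) @ p --> d * p.1 by exact: cvgM (cvg_cst _) c1.
  have cd2 : (fun p : R * R => - (d * p.2)) @ p --> - (d * p.2).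
    by apply: cvgN; exact: cvgM (cvg_cst _) c2.
  apply: cvgM; first exact: cvg_cst.
  apply: cvgM.
    by apply: (@continuous_comp _ _ _ (fun p : R * R => - (d * p.2)) expR);
    [exact: cd2|exact: continuous_expR].
  apply: cvgD; apply: cvgM => //.
  - by apply: cvgD => //; exact: cvg_cst.
  - by apply: (@continuous_comp _ _ _ (fun p : R * R => d * p.1) cos);
    [exact: cd1|exact: continuous_cos].
  - by apply: (@continuous_comp _ _ _ (fun p : R * R => d * p.1) sin);
    [exact: cd1|exact: continuous_sin].
have [[t0 s0] Kc Fmax] := compact_EVT_max (ex_intro _ _ (set_mem K0)) cK Fc.
have [/= tT sS] := KP _ Kc.
have F0c := Fmax _ K0.
have Fc0 : 0 < F (t0, s0).
  by apply: lt_le_trans F0c; apply: lt_le_trans F0; rewrite mulr_gt0 ?expR_gt0.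
have uc := ule tT (proj1 (andP sS)).
have t0T : - T < t0 < T.
  have side : t0 = T \/ t0 = - T -> False.
    by move=> /h_side hE; move: Fc0; rewrite /F /= hE; lra.
  have /andP[tl tr] := tT; rewrite !lt_neqAle tl tr !andbT; apply/andP.
  by split; apply/eqP => E; apply: side; lra.
have s0S : S < s0 < S'.
  have /andP[sl sr] := sS; rewrite !lt_neqAle sl sr !andbT; apply/andP.
  (* First the bottom side, then the top, where [u <= 0] leaves only [h]. *)
  split; apply/eqP => E.
    move: Fc0 uc; rewrite /F /= -E => Fc0 uc; have := h_bottom tT; lra.
  have := h_top tT (proj1 (andP sS)); rewrite E => ht0.
  have : F (t0, s0) < F (0, s1); last by lra.
  apply: le_lt_trans (lt_le_trans topS' F0); apply: le_trans ht0.
  rewrite /F /= E gerDr -E; apply: (le_trans uc).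
  by rewrite oppr_le0 mulr_ge0 ?expR_ge0// ltW.
apply: (no_interior_max psh t0T s0S _ _ Dt Ds Dtt Dss).
- by move=> t tT'; apply: inO; lra.
- by move=> s sS'; apply: inO; lra.
- by rewrite /htt /hss; ring.
- move=> t tT'; apply: (Fmax (t, s0)).
  by rewrite inE; split; rewrite /= in_itv/=; lra.
- move=> s sS'; apply: (Fmax (t0, s)).
  by rewrite inE; split; rewrite /= in_itv/=; lra.
Qed.

End Barrier.
End MaximumPrinciple.

(** * The boundary annulus *)

Lemma derive_le0_right (R : realType) (f : R -> R) (x l e : R) :
  is_derive x 1 f l -> 0 < e -> (forall h : R, 0 < h < e -> f (x + h) <= f x) ->
  l <= 0.
Proof.
move=> df e0 fle; rewrite leNgt; apply/negP => l0.
have [d /= d0 Hd] := derive_gt0_right df l0.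
pose h := Num.min d e / 2.
have h0 : 0 < h by rewrite divr_gt0// lt_min d0.
have md : Num.min d e <= d by rewrite ge_min lexx.
have me : Num.min d e <= e by rewrite ge_min lexx orbT.
have hd : h < d by rewrite /h in h0 *; lra.
have he : h < e by rewrite /h in h0 *; lra.
have : f x < f (x + h).
  by apply: Hd; rewrite /= ?ltrDl// opprD addrA subrr sub0r normrN gtr0_norm.
by rewrite ltNge fle// h0.
Qed.

(** Only steps to the right are compared, so that at an end of the annulus a curve moving inwards
    suffices. *)
Lemma derive_eq0_right (R : realType) (f : R -> R) (x l e : R) :
  is_derive x 1 f l -> 0 < e -> (forall h : R, 0 < h < e -> f (x + h) = f x) ->
  l = 0.
Proof.
move=> df e0 fE; apply/eqP; rewrite eq_le; apply/andP; split.
  by apply: (derive_le0_right df e0) => h /fE ->.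
rewrite -oppr_le0.
by apply: (derive_le0_right (is_derive_funN df) e0) => h /fE ->.
Qed.

(** A step towards 0 of length below [mu] passes 0 by less than [mu]. *)
Lemma inward_step (R : realType) (mu t h : R) : - mu <= t <= mu ->
  0 < h < mu -> - mu <= t + (if 0 <= t then -1 else 1) * h <= mu.
Proof. by move=> tmu hmu; case: ifPn; rewrite -?ltNge => t0; lra. Qed.

Section Worm.
Context {R : realType}.
Local Notation C2 := (C2 R).

Variables (mu : R) (eta : R -> R).
Hypotheses (mu0 : 0 < mu) (etaP : worm_profile mu eta).

Lemma worm_profile0 t : - mu <= t <= mu -> eta t = 0.
Proof.
case: etaP => _ _ E _ _ tmu.
suff : (eta @^-1` [set 0]) t by [].
by rewrite E /= in_itv.
Qed.

(** Here |z2|^2 = e^t, so log |z2|^2 = t and [eta t = 0]: the slice of the worm is the unit disc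
    about e^{it}. *)
Lemma worm_z1 (x y t s : R) : - mu <= t <= mu ->
  worm eta ((x, y), (expR (t / 2) * cos (s / 2), expR (t / 2) * sin (s / 2))) <->
  (x - cos t) ^+ 2 + (y - sin t) ^+ 2 < 1.
Proof.
move=> tmu; rewrite /worm /= /z2 /z1 /expi /=.
have -> : Num.sqrt ((expR (t / 2) * cos (s / 2)) ^+ 2 +
    (expR (t / 2) * sin (s / 2)) ^+ 2) ^+ 2 = expR t.
  rewrite sqr_sqrtr ?addr_ge0 ?sqr_ge0// !exprMn -mulrDr cos2Dsin2 mulr1.
  by rewrite expr2 -expRD; congr expR; lra.
rewrite expRK worm_profile0// subr0 sqr_sqrtr ?addr_ge0 ?sqr_ge0//.
split=> [[]//|->]; split=> //.
rewrite eq_complex /= !mulf_eq0 expR_eq0 /=.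
by rewrite cos_sin_neq0.
Qed.

Lemma worm_point_in r t s : - mu <= t <= mu -> 0 < r < 2 ->
  worm eta (worm_point (r, (t, s))).
Proof.
move=> tmu r02; apply/worm_z1 => //=.
have -> : (r * cos t - cos t) ^+ 2 + (r * sin t - sin t) ^+ 2 =
  (r - 1) ^+ 2 * (cos t ^+ 2 + sin t ^+ 2) by ring.
by rewrite cos2Dsin2 mulr1; nra.
Qed.

(** The points with small r > 0 lie in the worm and tend to this one, while at r = 0 the distance
    from z1 to e^{it} is exactly 1. *)
Lemma worm_point_boundary t s : - mu <= t <= mu ->
  boundary (worm eta) (worm_point (0, (t, s))).
Proof.
move=> tmu; split.
  move=> B /= /(@continuous_worm_point R (0, (t, s))) [[A1 A2] /= [n1 n2] AB].
  have [e /= e0 eA] := n1.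
  pose r := Num.min e 1 / 2.
  have r0 : 0 < r by rewrite divr_gt0// lt_min e0 ltr01.
  have me : Num.min e 1 <= e by rewrite ge_min lexx.
  have m1 : Num.min e 1 <= 1 by rewrite ge_min lexx orbT.
  have re : r < e by rewrite /r in r0 *; lra.
  have r1 : r < 1 by rewrite /r in r0 *; lra.
  exists (worm_point (r, (t, s))); split; first by apply: worm_point_in => //; lra.
  apply: (AB (r, (t, s))); split; last exact: nbhs_singleton n2.
  by apply: eA; rewrite /ball_ /= sub0r normrN gtr0_norm.
move=> /interior_subset /worm_z1 => /(_ tmu).
by rewrite /= !mul0r !sub0r !sqrrN cos2Dsin2 ltxx.
Qed.

End Worm.

Lemma continuous_lincomb4 (R : realType) (T : topologicalType) (q : T)
    (a b c d f g h k : T -> R) :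
  {for q, continuous a} -> {for q, continuous b} ->
  {for q, continuous c} -> {for q, continuous d} ->
  {for q, continuous f} -> {for q, continuous g} ->
  {for q, continuous h} -> {for q, continuous k} ->
  {for q, continuous (fun x => a x * f x + b x * g x + c x * h x + d x * k x)}.
Proof.
by move=> *; apply: cvgD; [apply: cvgD; [apply: cvgD|]|]; apply: cvgM.
Qed.

(** * Two-sided bounds for the defining function near the annulus *)

Section Bounds.
Context {R : realType}.
Local Notation C2 := (C2 R).
Variables (mu : R) (eta : R -> R).
Hypotheses (mu0 : 0 < mu) (etaP : worm_profile mu eta).
Variables (rho : C2 -> R) (U : set C2).
Hypothesis rho_smooth : smooth_on U rho.
Hypothesis rho_neg : worm eta = [set z | U z /\ rho z < 0].
Hypothesis rho_zero : boundary (worm eta) = [set z | U z /\ rho z = 0].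
Hypothesis rho_grad : forall z, boundary (worm eta) z -> gradient rho z != 0.

Lemma smooth_differentiable z : U z -> differentiable rho z.
Proof. by move=> /(rho_smooth 1 [::])[_]; apply. Qed.

Lemma smooth_partial_x z j : U z -> {for z, continuous ('D_(xdir j) rho)}.
Proof. by move=> /(rho_smooth 1 [:: xdir j])[+ _]; apply. Qed.

Lemma smooth_partial_y z j : U z -> {for z, continuous ('D_(ydir j) rho)}.
Proof. by move=> /(rho_smooth 1 [:: ydir j])[+ _]; apply. Qed.

Lemma rho_boundary t s : - mu <= t <= mu ->
  U (worm_point (0, (t, s))) /\ rho (worm_point (0, (t, s))) = 0.
Proof.
move=> tmu; have := worm_point_boundary etaP s tmu.
by rewrite rho_zero.
Qed.

Lemma rho_worm_lt0 z : worm eta z -> rho z < 0.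
Proof. by rewrite rho_neg => -[]. Qed.

(** The derivative of [rho] in the direction e^{it} of z1, as a function of (r, (t, s)) so that its
    sign at r = 0 spreads to small r by continuity. *)
Definition radial_derive (q : R * (R * R)) : R :=
  grad_dot rho (worm_point q) ((cos q.2.1, sin q.2.1), (0, 0)).

Lemma is_derive_radial r t s : U (worm_point (r, (t, s))) ->
  is_derive r 1 (fun r => rho (worm_point (r, (t, s)))) (radial_derive (r, (t, s))).
Proof.
move=> Uz.
have D1 : is_derive r 1 (fun r => r * cos t) (cos t) by prove_is_derive.
have D2 : is_derive r 1 (fun r => r * sin t) (sin t) by prove_is_derive.
have D3 : is_derive r 1 (fun r : R => expR (t / 2) * cos (s / 2)) 0.
  exact: is_derive_fun_cst.
have D4 : is_derive r 1 (fun r : R => expR (t / 2) * sin (s / 2)) 0.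
  exact: is_derive_fun_cst.
exact: is_derive_C2_curve D1 D2 D3 D4 (smooth_differentiable Uz).
Qed.

Section BoundaryPoint.
Variables t s : R.
Hypothesis tmu : - mu <= t <= mu.
Let p := worm_point (0, (t, s)).

(* The disc |z1 - e^{it}| < 1 lies in the slice of the worm. *)
Lemma grad_disc_le0 (a b : R) : 0 < a ->
  grad_dot rho p ((a * cos t - b * sin t, a * sin t + b * cos t), (0, 0)) <= 0.
Proof.
move=> a0; have [Up rp] := rho_boundary s tmu.
pose x1 (h : R) := h * (a * cos t - b * sin t).
pose y1 (h : R) := h * (a * sin t + b * cos t).
pose x2 (h : R) := expR (t / 2) * cos (s / 2).
pose y2 (h : R) := expR (t / 2) * sin (s / 2).
have D1 : is_derive (0 : R) 1 x1 (a * cos t - b * sin t) by rewrite /x1; prove_is_derive.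
have D2 : is_derive (0 : R) 1 y1 (a * sin t + b * cos t) by rewrite /y1; prove_is_derive.
have D3 : is_derive (0 : R) 1 x2 0 by exact: is_derive_fun_cst.
have D4 : is_derive (0 : R) 1 y2 0 by exact: is_derive_fun_cst.
have c0 : ((x1 0, y1 0), (x2 0, y2 0)) = p :> C2.
  by rewrite /x1 /y1 /p /worm_point /= !mul0r.
have dr : differentiable rho ((x1 0, y1 0), (x2 0, y2 0)).
  by rewrite c0; exact: smooth_differentiable.
have := is_derive_C2_curve D1 D2 D3 D4 dr.
rewrite c0 => D.
(* Since |h (a + ib) - 1|^2 = 1 - h (2a - h (a^2 + b^2)), a step h > 0 stays inside the disc exactly
   below this bound. *)
have e0 : 0 < 2 * a / (a ^+ 2 + b ^+ 2).
  by rewrite divr_gt0//; [lra|have := sqr_ge0 b; nra].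
apply: (derive_le0_right D e0) => h; rewrite ltr_pdivlMr; last first.
  by have := sqr_ge0 b; nra.
move=> h0; rewrite add0r c0 rp ltW//; apply: rho_worm_lt0.
apply/(worm_z1 etaP) => //; rewrite /x1 /y1.
have -> : (h * (a * cos t - b * sin t) - cos t) ^+ 2 +
  (h * (a * sin t + b * cos t) - sin t) ^+ 2 =
  (1 - h * (2 * a - h * (a ^+ 2 + b ^+ 2))) * (cos t ^+ 2 + sin t ^+ 2) by ring.
by rewrite cos2Dsin2 mulr1 gtrBl mulr_gt0//; lra.
Qed.

Lemma grad_annulus_t :
  grad_dot rho p ((0, 0), (2^-1 * (expR (t / 2) * cos (s / 2)),
                           2^-1 * (expR (t / 2) * sin (s / 2)))) = 0.
Proof.
have [Up rp] := rho_boundary s tmu.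
(* At t = mu or t = -mu only moves towards 0 stay on the annulus, where [rho] is 0; [sg] is the sign
   of such a move. *)
pose sg : R := if 0 <= t then -1 else 1.
pose x1 (h : R) : R := 0.
pose y1 (h : R) : R := 0.
pose x2 (h : R) := expR ((t + sg * h) / 2) * cos (s / 2).
pose y2 (h : R) := expR ((t + sg * h) / 2) * sin (s / 2).
have D1 : is_derive (0 : R) 1 x1 0 by exact: is_derive_fun_cst.
have D2 : is_derive (0 : R) 1 y1 0 by exact: is_derive_fun_cst.
have D3 : is_derive (0 : R) 1 x2 (sg * (2^-1 * (expR (t / 2) * cos (s / 2)))).
  have -> : t / 2 = (t + sg * 0) / 2 by rewrite mulr0 addr0.
  by rewrite /x2; prove_is_derive.
have D4 : is_derive (0 : R) 1 y2 (sg * (2^-1 * (expR (t / 2) * sin (s / 2)))).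
  have -> : t / 2 = (t + sg * 0) / 2 by rewrite mulr0 addr0.
  by rewrite /y2; prove_is_derive.
have cE h : ((x1 h, y1 h), (x2 h, y2 h)) = worm_point (0, (t + sg * h, s)).
  by rewrite /x1 /y1 /worm_point /= !mul0r.
have c0 : ((x1 0, y1 0), (x2 0, y2 0)) = p by rewrite cE mulr0 addr0.
have dr : differentiable rho ((x1 0, y1 0), (x2 0, y2 0)).
  by rewrite c0; exact: smooth_differentiable.
have := is_derive_C2_curve D1 D2 D3 D4 dr.
rewrite c0 => D.
have : grad_dot rho p ((0, 0), (sg * (2^-1 * (expR (t / 2) * cos (s / 2))),
    sg * (2^-1 * (expR (t / 2) * sin (s / 2))))) = 0.
  apply: (derive_eq0_right D mu0) => h hmu; rewrite add0r c0 rp cE.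
  apply: (proj2 (rho_boundary s _)).
  exact: inward_step.
have alg (c d X Y Z W : R) : 0 * X + 0 * Y + sg * c * Z + sg * d * W = 0 ->
    0 * X + 0 * Y + c * Z + d * W = 0.
  have : sg * sg = 1 by rewrite /sg; case: ifP => _; ring.
  move=> sg2 E.
  have -> : 0 * X + 0 * Y + c * Z + d * W =
    (sg * sg) * c * Z + (sg * sg) * d * W by rewrite sg2; ring.
  have -> : (sg * sg) * c * Z + (sg * sg) * d * W =
    sg * (0 * X + 0 * Y + sg * c * Z + sg * d * W) by ring.
  by rewrite E mulr0.
exact: alg.
Qed.

(** Rotating z2 keeps the point on the annulus, where [rho] is 0. *)
Lemma grad_annulus_s :
  grad_dot rho p ((0, 0), (- (2^-1 * (expR (t / 2) * sin (s / 2))),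
                           2^-1 * (expR (t / 2) * cos (s / 2)))) = 0.
Proof.
have [Up rp] := rho_boundary s tmu.
pose x1 (h : R) : R := 0.
pose y1 (h : R) : R := 0.
pose x2 (h : R) := expR (t / 2) * cos (h / 2).
pose y2 (h : R) := expR (t / 2) * sin (h / 2).
have D1 : is_derive s 1 x1 0 by exact: is_derive_fun_cst.
have D2 : is_derive s 1 y1 0 by exact: is_derive_fun_cst.
have D3 : is_derive s 1 x2 (- (2^-1 * (expR (t / 2) * sin (s / 2)))).
  by rewrite /x2; prove_is_derive.
have D4 : is_derive s 1 y2 (2^-1 * (expR (t / 2) * cos (s / 2))).
  by rewrite /y2; prove_is_derive.
have cE h : ((x1 h, y1 h), (x2 h, y2 h)) = worm_point (0, (t, h)).
  by rewrite /x1 /y1 /worm_point /= !mul0r.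
have dr : differentiable rho ((x1 s, y1 s), (x2 s, y2 s)).
  by rewrite cE; exact: smooth_differentiable.
have := is_derive_C2_curve D1 D2 D3 D4 dr.
rewrite cE => D.
apply: (derive_eq0_right D ltr01) => h _; rewrite !cE rp.
exact: (proj2 (rho_boundary (s + h) tmu)).
Qed.

(** Were it nonnegative, the disc inequality with a = 1, b = 0 would make it 0, and with b = 1 and b
    = -1 would make the tangential derivative in z1 vanish. The annulus identities kill the
    z2-derivatives, so the gradient would be 0. *)
Lemma radial_derive_lt0 : radial_derive (0, (t, s)) < 0.
Proof.
have radE : radial_derive (0, (t, s)) = grad_dot rho p ((cos t, sin t), (0, 0)) by [].
rewrite radE ltNge; apply/negP => ge0.
have g10 := @grad_disc_le0 1 0 ltr01.
have g11 := @grad_disc_le0 1 1 ltr01.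
have g1N := @grad_disc_le0 1 (-1) ltr01.
have gt := grad_annulus_t.
have gs := grad_annulus_s.
have := rho_grad (worm_point_boundary etaP s tmu).
have alg (X Y Z W c d c' d' E : R) : c ^+ 2 + d ^+ 2 = 1 -> c' ^+ 2 + d' ^+ 2 = 1 ->
  0 < E ->
  0 <= c * X + d * Y + 0 * Z + 0 * W ->
  (1 * c - 0 * d) * X + (1 * d + 0 * c) * Y + 0 * Z + 0 * W <= 0 ->
  (1 * c - 1 * d) * X + (1 * d + 1 * c) * Y + 0 * Z + 0 * W <= 0 ->
  (1 * c - -1 * d) * X + (1 * d + -1 * c) * Y + 0 * Z + 0 * W <= 0 ->
  0 * X + 0 * Y + 2^-1 * (E * c') * Z + 2^-1 * (E * d') * W = 0 ->
  0 * X + 0 * Y + - (2^-1 * (E * d')) * Z + 2^-1 * (E * c') * W = 0 ->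
  [/\ X = 0, Y = 0, Z = 0 & W = 0].
  move=> cd cd' E0 h1 h2 h3 h4 h5 h6.
  have e1 : c * X + d * Y = 0 by lra.
  have e2 : c * Y - d * X = 0 by lra.
  have E20 : 2^-1 * E != 0 by rewrite gt_eqF//; lra.
  have e3 : c' * Z + d' * W = 0.
    by apply: (mulfI E20); rewrite mulr0 -[RHS]h5; ring.
  have e4 : c' * W - d' * Z = 0.
    by apply: (mulfI E20); rewrite mulr0 -[RHS]h6; ring.
  split.
  - rewrite -[LHS]mul1r -cd.
    have -> : (c ^+ 2 + d ^+ 2) * X = c * (c * X + d * Y) - d * (c * Y - d * X) by ring.
    by rewrite e1 e2 !mulr0 subr0.
  - rewrite -[LHS]mul1r -cd.
    have -> : (c ^+ 2 + d ^+ 2) * Y = d * (c * X + d * Y) + c * (c * Y - d * X) by ring.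
    by rewrite e1 e2 !mulr0 addr0.
  - rewrite -[LHS]mul1r -cd'.
    have -> : (c' ^+ 2 + d' ^+ 2) * Z = c' * (c' * Z + d' * W) - d' * (c' * W - d' * Z) by ring.
    by rewrite e3 e4 !mulr0 subr0.
  - rewrite -[LHS]mul1r -cd'.
    have -> : (c' ^+ 2 + d' ^+ 2) * W = d' * (c' * Z + d' * W) + c' * (c' * W - d' * Z) by ring.
    by rewrite e3 e4 !mulr0 addr0.
have [X0 Y0 Z0 W0] := alg _ _ _ _ _ _ _ _ _ (cos2Dsin2 t) (cos2Dsin2 (s / 2))
  (expR_gt0 (t / 2)) ge0 g10 g11 g1N gt gs.
move=> /eqP; apply.
have pair0 (X Y Z W : R) : X = 0 -> Y = 0 -> Z = 0 -> W = 0 ->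
  ((X, Y), (Z, W)) = 0 :> C2 by move=> -> -> -> ->.
exact: pair0 X0 Y0 Z0 W0.
Qed.

End BoundaryPoint.

Lemma continuous_radial_derive (q : R * (R * R)) : U (worm_point q) ->
  {for q, continuous radial_derive}.
Proof.
move=> Uq.
have wq := @continuous_worm_point R q.
have c' : continuous (fun p : R * (R * R) => p.2) by move=> p; exact: cvg_snd.
have c1 : continuous (fun p : R * (R * R) => p.2.1).
  by move=> p; apply: (@continuous_comp _ _ _ snd fst);
    [exact: c'|exact: cvg_fst].
have cC : {for q, continuous (fun q : R * (R * R) => cos q.2.1)}.
  by apply: (@continuous_comp _ _ _ (fun q => q.2.1) cos);
    [exact: c1|exact: continuous_cos].
have cS : {for q, continuous (fun q : R * (R * R) => sin q.2.1)}.
  by apply: (@continuous_comp _ _ _ (fun q => q.2.1) sin);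
    [exact: c1|exact: continuous_sin].
have cx j : {for q, continuous (fun q => 'D_(xdir j) rho (worm_point q))}.
  by apply: (@continuous_comp _ _ _ worm_point ('D_(xdir j) rho));
    [exact: wq|exact: smooth_partial_x].
have cy j : {for q, continuous (fun q => 'D_(ydir j) rho (worm_point q))}.
  by apply: (@continuous_comp _ _ _ worm_point ('D_(ydir j) rho));
    [exact: wq|exact: smooth_partial_y].
have c0 : {for q, continuous (fun=> 0 : R)} by exact: cvg_cst.
exact: (continuous_lincomb4 cC cS c0 c0 (cx 0) (cy 0) (cx 1) (cy 1)).
Qed.

(** One [e] serves as range of r, lower constant and inverse of the upper constant, so that the
    bounds become a property of small [e] that compactness can make uniform. *)
Let bounds (e : R) (x : R * R) := forall r, 0 < r < e ->
  e * r <= - rho (worm_point (r, x)) <= e^-1 * r.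

Hypothesis Uo : open U.

(** Near r = 0 the radial derivative stays between 2g and g/2, where g < 0 is its value at the
    boundary point; the mean value theorem on [0, r], starting from [rho = 0], gives both bounds. *)
Lemma local_rho_bounds (x : R * R) : - mu <= x.1 <= mu ->
  \forall x' \near x & e \near 0^'+, - mu <= x'.1 <= mu -> bounds e x'.
Proof.
case: x => t s /= tmu.
have [Up _] := rho_boundary s tmu.
have g0 := radial_derive_lt0 s tmu.
set g := radial_derive (0, (t, s)) in g0.
have cg := continuous_radial_derive Up.
have near0 : \forall q \near ((0, (t, s)) : R * (R * R)),
    [/\ U (worm_point q), radial_derive q < g / 2 & 2 * g < radial_derive q].
  near=> q; split; near: q.
  - exact: (continuous_worm_point (open_nbhs_nbhs (conj Uo Up))).
  - by apply: (cvgr_lt g cg); lra.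
  - by apply: (cvgr_gt g cg); lra.
case: near0 => -[A B] /= [[a /= a0 Aa] nB] AB.
(* The three terms keep [0, r] in the neighbourhood, give e < -g/2 for the lower bound, and give -2g
   < 1/e for the upper one. *)
have m0 : 0 < Num.min a (Num.min (- g / 2) ((- (2 * g))^-1)).
  by rewrite !lt_min a0 invr_gt0 /=; apply/andP; split; lra.
exists (B, [set e | 0 < e < Num.min a (Num.min (- g / 2) ((- (2 * g))^-1))]).
  split=> //; exists (Num.min a (Num.min (- g / 2) ((- (2 * g))^-1))) => //= e.
  by rewrite /ball_ /= sub0r normrN => he e0; rewrite gtr0_norm// in he; rewrite e0.
move=> [[t' s'] e] /= [Bx /andP[e0]]; rewrite !lt_min => /and3P[ea eg1 eg2].
move=> t'mu r /andP[r0 re].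
have inAB c : 0 <= c <= r -> [/\ U (worm_point (c, (t', s'))),
    radial_derive (c, (t', s')) < g / 2 &
    2 * g < radial_derive (c, (t', s'))].
  move=> /andP[c0 cr]; apply: (AB (c, (t', s'))); split => //=.
  by apply: Aa; rewrite /ball_ /= sub0r normrN ger0_norm//; lra.
have [_ rho0] := rho_boundary s' t'mu.
have der c : 0 <= c <= r -> is_derive c 1 (fun r => rho (worm_point (r, (t', s'))))
    (radial_derive (c, (t', s'))).
  by move=> /inAB[Uc _ _]; exact: is_derive_radial.
have der_in c : c \in `]0, r[ -> is_derive c 1
    (fun r => rho (worm_point (r, (t', s')))) (radial_derive (c, (t', s'))).
  by rewrite in_itv /= => /andP[c0 cr]; apply: der; rewrite !ltW.
have cont : {within `[0, r], continuous (fun r => rho (worm_point (r, (t', s'))))}.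
  by apply: derivable_within_continuous => c; rewrite in_itv /= => /der[].
have [c] := MVT r0 der_in cont.
rewrite in_itv /= => c0r; rewrite rho0 !subr0 => rhoE.
have [_ g1 g2] := inAB c ltac:(lra).
rewrite rhoE.
have e1 : - (2 * g) < e^-1 by rewrite -[ltLHS]invrK ltf_pV2 ?posrE// invr_gt0; lra.
move: (radial_derive (c, _)) g1 g2 => y g1 g2.
rewrite -mulNr !ler_pM2r//; lra.
Unshelve. all: by end_near. Qed.

(** Compactness makes the local [e] uniform. The length 4 pi is a full period of [s], since z2 =
    e^{(t+is)/2}. *)
Lemma rho_bounds_compact : exists2 e : R, 0 < e & forall t s : R,
  - mu <= t <= mu -> 0 <= s <= 4 * pi -> bounds e (t, s).
Proof.
have cK : compact (`[- mu, mu] `*` `[0, 4 * pi] : set (R * R)).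
  by apply: compact_setX; exact: segment_compact.
have /compact_near_coveringP/near_covering_withinP cov := cK.
have H := cov R (0^'+) bounds _ _.
have {}H : \forall e \near 0^'+, `[- mu, mu] `*` `[0, 4 * pi] `<=` bounds e.
  apply: H => -[t s] [/=]; rewrite !in_itv /= => tmu _.
  apply: filterS (@local_rho_bounds (t, s) tmu) => -[x' e] /= Hx [] /=.
  by rewrite in_itv /= => /Hx.
have [e [e0 He]] : exists e : R, 0 < e /\ `[- mu, mu] `*` `[0, 4 * pi] `<=` bounds e.
  have := filter_ex (filterI (nbhs_right_gt (0 : R)) H).
  by case=> e [e0 He]; exists e.
by exists e => // t s tmu s4; apply: He; split; rewrite /= in_itv.
Qed.

Lemma worm_point_period (r t s : R) n :
  worm_point (r, (t, s + (4 * pi) *+ n)) = worm_point (r, (t, s)) :> C2.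
Proof.
rewrite /worm_point /=.
have -> : (s + 4 * pi *+ n) / 2 = s / 2 + (pi *+ 2) *+ n.
  rewrite -[(4 * pi) *+ n]mulr_natl -[pi *+ 2 *+ n]mulr_natl -[pi *+ 2]mulr_natl.
  by field.
by rewrite (periodicn (@cosD2pi R)) (periodicn (@sinD2pi R)).
Qed.

(** Subtracting [Num.truncn (s / (4 * pi))] periods brings [s] back to [0, 4 pi]. *)
Lemma rho_bounds : exists2 e : R, 0 < e & forall t s r : R,
  - mu <= t <= mu -> 0 <= s -> 0 < r < e ->
  e * r <= - rho (worm_point (r, (t, s))) <= e^-1 * r.
Proof.
have [e e0 He] := rho_bounds_compact; exists e => // t s r tmu s0 re.
have p0 : 0 < 4 * pi :> R by rewrite mulr_gt0// pi_gt0.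
have s4 : 0 <= s / (4 * pi) by rewrite divr_ge0// ltW.
have /andP[n1 n2] := truncn_itv s4; set n := Num.truncn _ in n1 n2.
have -> : s = (s - (4 * pi) *+ n) + (4 * pi) *+ n by rewrite subrK.
rewrite worm_point_period; apply: He => //.
rewrite -[(4 * pi) *+ n]mulr_natl subr_ge0 lerBlDr.
rewrite -ler_pdivlMr// n1 /=.
move: n2; rewrite ltr_pdivrMr// -natr1 mulrDl mul1r; lra.
Qed.

End Bounds.

(** * The bound on the exponent *)

Lemma worm_exponent_lt (R : realType) (mu : R) (eta : R -> R) (rho : C2 R -> R)
    (delta : R) :
  0 < mu -> worm_profile mu eta -> defining_function (worm eta) rho -> 0 < delta ->
  strictly_psh (worm eta) (fun z => - (- rho z) `^ delta) ->
  delta < pi / (2 * mu).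
Proof.
move=> mu0 etaP [U [[Uo _] smooth neg zero grad]] d0 psh.
rewrite ltNge; apply/negP => dmu.
have [e e0 He] := rho_bounds mu0 etaP smooth neg zero grad Uo.
(* The half-width at which cos (delta t) first vanishes; the assumption on [delta] says precisely
   that it is at most [mu]. *)
pose T := pi / (2 * delta).
have Tmu : T <= mu.
  rewrite /T ler_pdivrMr ?mulr_gt0//.
  by move: dmu; rewrite ler_pdivrMr ?mulr_gt0//; lra.
have dT : delta * T = pi / 2 by rewrite /T; field; rewrite gt_eqF.
(* For s >= S this gives s > 0 and e^{-s} < e, the range of [rho_bounds]. *)
pose S := `|ln e| + 1.
have S0 : 0 <= S by rewrite addr_ge0.
have rS s : S <= s -> 0 < expR (- s) < e.
  move=> Ss; rewrite expR_gt0 /= -[ltRHS](@lnK _ e) ?posrE// ltr_expR.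
  have : - ln e <= `|ln e| by rewrite -normrN ler_norm.
  by move: Ss; rewrite /S; lra.
have rM s x : 0 < x -> (x * expR (- s)) `^ delta = x `^ delta * expR (- (delta * s)).
  move=> x0; rewrite powRM ?expR_ge0 ?ltW// -expRM; congr (_ * expR _); ring.
have bd t s : - T <= t <= T -> S <= s ->
    e * expR (- s) <= - rho (worm_curve t s) <= e^-1 * expR (- s).
  move=> tT Ss; apply: He; [lra|lra|exact: rS].
(* The constants are the delta-th powers of those in [rho_bounds], since (x e^{-s})^delta = x^delta
   e^{-delta s}. *)
apply: (no_psh_between_exponentials psh d0 dT (m := e `^ delta)
  (M := e^-1 `^ delta) (S := S)).
- by rewrite powR_gt0.
- move=> t s tT Ss; apply: (worm_point_in etaP); first lra.
  rewrite expR_gt0 /=; apply: (@le_lt_trans _ _ 1); last lra.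
  by rewrite -expR0 ler_expR; lra.
- move=> t s tT Ss; have /andP[lo _] := bd t s tT Ss.
  rewrite lerN2 -rM// ge0_ler_powR ?nnegrE ?mulr_ge0 ?expR_ge0// ltW//.
  by apply: lt_le_trans lo; rewrite mulr_gt0 ?expR_gt0.
- move=> t s tT Ss; have /andP[lo hi] := bd t s tT Ss.
  have r0 : 0 <= - rho (worm_curve t s).
    by apply: le_trans lo; rewrite mulr_ge0 ?expR_ge0// ltW.
  rewrite lerN2 -rM ?invr_gt0//; apply: ge0_ler_powR (hi); rewrite ?nnegrE//.
    exact: ltW.
  exact: le_trans r0 hi.
Qed.

Theorem theorem2p5 (R : realType) :
  (forall delta0 : R, 0 < delta0 ->
     exists2 mu0 : R, 0 < mu0 &
       forall mu : R, mu0 <= mu ->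
       forall (eta : R -> R), worm_profile mu eta ->
       forall (rho : C2 R -> R) (delta : R),
         defining_function (worm eta) rho -> 0 < delta ->
         bounded_psh_exhaustion (worm eta) (fun z => - (- rho z) `^ delta) ->
         delta < delta0) /\
  (forall mu : R, 0 < mu ->
     forall (eta : R -> R), worm_profile mu eta ->
     forall (rho : C2 R -> R) (delta : R),
       defining_function (worm eta) rho -> 0 < delta ->
       bounded_psh_exhaustion (worm eta) (fun z => - (- rho z) `^ delta) ->
       delta < pi / (2 * mu)).
Proof.
split=> [delta0 delta0_gt0|mu mu0 eta etaP rho delta df d0 [_ psh _ _ _]]; last first.
  exact: worm_exponent_lt psh.
(* The value of mu at which pi / (2 mu) equals [delta0]. *)
exists (pi / (2 * delta0)); first by rewrite divr_gt0 ?pi_gt0// mulr_gt0.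
move=> mu mu_ge eta etaP rho delta df d0 [_ psh _ _ _].
have mu0 : 0 < mu by apply: lt_le_trans mu_ge; rewrite divr_gt0 ?pi_gt0// mulr_gt0.
apply: lt_le_trans (worm_exponent_lt mu0 etaP df d0 psh) _.
rewrite ler_pdivrMr ?mulr_gt0//.
by move: mu_ge; rewrite ler_pdivrMr ?mulr_gt0//; lra.
Qed.
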